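(* Let $X=(X(t))_{t\in\mathbb{R}}$ be the positive supOU process with characteristics $\pi$ and $\lambda$ (as defined in the context). Assume that $\int_{(0,1]} z\,\lambda(\mathrm{d}z)<\infty$. If $m_0(\pi)=\pi((0,\infty))=\infty$, then almost surely $$\sup_{t\in[0,1]}X(t)\ge\sup\{z>0:\overline{\lambda}(z)>0\}.$$ In particular, if the jump sizes are unbounded (i.e. $\overline{\lambda}(z)>0$ for all $z>0$), then $$\sup_{t\in[0,1]}X(t)=\infty\quad\text{almost surely.}$$
   Context: For a measure $Q$ on $(0,\infty)$ write $m_p(Q)=\int_{(0,\infty)}x^p\,Q(\mathrm{d}x)$ and $\overline{Q}(x)=Q((x,\infty))$ for $x>0$. Setting: $\pi$ is a measure on $(0,\infty)$ with $m_{-1}(\pi)=\int_{(0,\infty)}x^{-1}\pi(\mathrm{d}x)<\infty$. $\lambda$ is a nonzero Lévy measure on $(0,\infty)$, i.e. $\int_{(0,\infty)}(1\wedge z^2)\lambda(\mathrm{d}z)<\infty$, satisfying $\int_{(1,\infty)}\log z\,\lambda(\mathrm{d}z)<\infty$. $\mu$ is a Poisson random measure on $(0,\infty)\times\mathbb{R}\times(0,\infty)$ with intensity measure $\nu(\mathrm{d}x,\mathrm{d}s,\mathrm{d}z)=\pi(\mathrm{d}x)\,\mathrm{d}s\,\lambda(\mathrm{d}z)$, with points $(\xi_k,\tau_k,\zeta_k)_{k\ge 0}$. When $\int_{(0,1]}z\,\lambda(\mathrm{d}z)<\infty$, the positive supOU process (drift chosen so that there is no centering) is defined, for every $t\in\mathbb{R}$,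 by $$X(t)=\sum_{k:\tau_k\le t}e^{-\xi_k(t-\tau_k)}\zeta_k\in[0,\infty].$$ *)

(* Defs.v *)
(* MathComp-Analysis.  A measure on (0,oo) is a Borel measure on R that does
   not charge ]-oo, 0] (see [on_positive]), and the points (x, s, z) of
   (0,oo) x R x (0,oo) are represented as ((x, s), z) : R * R * R. *)
From HB Require Import structures.
From mathcomp Require Export all_boot all_order all_algebra.
From mathcomp Require Export all_classical all_reals all_analysis measurable_realfun.

Set Implicit Arguments.
Unset Strict Implicit.
Unset Printing Implicit Defensive.

Import Order.TTheory GRing.Theory Num.Theory.
Import numFieldNormedType.Exports.

Local Open Scope classical_set_scope.
Local Open Scope ring_scope.
Local Open Scope ereal_scope.

Definition on_positive (R : realType) (Q : {measure set R -> \bar R}) : Prop :=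
  Q `]-oo, 0%R]%classic = 0.

Definition moment (R : realType) (p : R) (Q : {measure set R -> \bar R}) :
    \bar R :=
  \int[Q]_(x in `]0%R, +oo[) (x `^ p)%:E.

Definition tail (R : realType) (Q : {measure set R -> \bar R}) (x : R) :
    \bar R :=
  Q `]x, +oo[%classic.

Definition levy_measure (R : realType) (Q : {measure set R -> \bar R}) : Prop :=
  on_positive Q /\
  \int[Q]_(z in `]0%R, +oo[) (Num.min 1%R (z ^+ 2)%R)%:E < +oo.

(* Mutual independence; product formulas over subfamilies are obtained by
   taking some of the [B i] equal to the full set. *)
Definition mutually_independent (R : realType) (d : measure_display)
    (Omega : measurableType d) (P : probability Omega R) (n : nat)
    (Y : 'I_n -> Omega -> \bar R) : Prop :=
  forall B : 'I_n -> set (\bar R), (forall i, measurable (B i)) ->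
    P (\bigcap_(i in [set: 'I_n]) (Y i @^-1` B i)) =
    \prod_(i < n) P (Y i @^-1` B i).

(* A random measure is a kernel from the probability space.  The second
   (natural number) argument of [poisson_prob] is a dummy; at rate 0 that
   measure is the Dirac mass at 0. *)
Definition poisson_random_measure (R : realType) (d d' : measure_display)
    (Omega : measurableType d) (E : measurableType d')
    (P : probability Omega R) (nu : set E -> \bar R)
    (N : R.-ker Omega ~> E) : Prop :=
  [/\ (forall A : set E, measurable A -> nu A < +oo -> forall k : nat,
         P [set w | N w A = k%:R%:E] =
         poisson_prob (fine (nu A)) 0%N [set k]),
      (forall A : set E, measurable A -> nu A = +oo ->
         \forall w \ae P, N w A = +oo) &
      (forall (n : nat) (A : 'I_n -> set E), (forall i, measurable (A i)) ->
         trivIset [set: 'I_n] A ->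
         mutually_independent P (fun i w => N w (A i)))].

Definition supOU_intensity (R : realType)
    (pi lambda : {measure set R -> \bar R}) : set (R * R * R) -> \bar R :=
  (pi \x lebesgue_measure) \x lambda.

Definition has_points (R : realType) (d : measure_display)
    (Omega : measurableType d) (P : probability Omega R)
    (N : R.-ker Omega ~> (R * R * R)%type)
    (xi tau zeta : nat -> {RV P >-> R}) : Prop :=
  (forall k w, (0 < xi k w)%R /\ (0 < zeta k w)%R) /\
  (\forall w \ae P, forall A : set (R * R * R), measurable A ->
     N w A = \sum_(k <oo) \d_(xi k w, tau k w, zeta k w) A).

Definition supOU (R : realType) (d : measure_display)
    (Omega : measurableType d) (P : probability Omega R)
    (xi tau zeta : nat -> {RV P >-> R}) (t : R) (w : Omega) : \bar R :=
  \esum_(k in [set k | (tau k w <= t)%R])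
    (expR (- xi k w * (t - tau k w)) * zeta k w)%:E.

(* Main.v *)
Require Import Defs.
From mathcomp Require Import all_boot all_order all_algebra.
From mathcomp Require Import all_classical all_reals all_analysis measurable_realfun.
Import Order.TTheory GRing.Theory Num.Theory.
Import numFieldNormedType.Exports.

Local Open Scope classical_set_scope.
Local Open Scope ring_scope.
Local Open Scope ereal_scope.

(** A single jump is enough.  At the time [tau k] of its own jump, the [k]-th
    term of the process has not decayed yet, so that [X(tau k) >= zeta k].
    Hence the supremum of [X] over [[0, 1]] exceeds [q] as soon as one point of
    the Poisson random measure lies in
    [(0, +oo) x [0, 1] x (q, +oo)].  The intensity of this box is
    [pi (0, +oo) * 1 * tail lambda q], which is infinite whenever
    [tail lambda q > 0], because [pi] has infinite mass
    ([supOU_intensity_box]).  The random measure is then almost surely infinite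
    on the box, so that the box contains a point ([ae_point_in]).

    The null set depends on the level [q], and the levels are uncountably many.
    Restricting to rational levels leaves one null set, and nothing is lost:
    [tail lambda] is nonincreasing, so every rational level below a level of
    positive tail has positive tail too.  The unbounded case follows, as the
    supremum of all positive levels is [+oo]. *)

(** The product is an iterated integral, and the section of a rectangle is either
    [A2] or empty, so that the integrand is a constant on [A1] and zero outside.
    Here [m2] is any measure, whereas [product_measure1E] is about a
    sigma-finite one: the jump measure comes without that structure. *)
Lemma product_measure1_rectangle (d1 d2 : measure_display)
    (T1 : measurableType d1) (T2 : measurableType d2) (R : realType)
    (m1 : {measure set T1 -> \bar R}) (m2 : {measure set T2 -> \bar R})
    (A1 : set T1) (A2 : set T2) :
  measurable A1 -> (m1 \x m2) (A1 `*` A2) = m2 A2 * m1 A1.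
Proof.
move=> mA1; rewrite /product_measure1 -integral_cst// [RHS]integral_mkcond.
apply: eq_integral => x _; rewrite /= patchE.
by have [xA|xA] := boolP (x \in A1);
  [rewrite in_xsectionX|rewrite notin_xsectionX// measure0].
Qed.

Lemma moment0 (R : realType) (Q : {measure set R -> \bar R}) :
  moment 0%R Q = Q `]0%R, +oo[%classic.
Proof.
rewrite /moment; under eq_integral do rewrite powRr0.
by rewrite -[RHS]mul1e -integral_cst.
Qed.

Lemma le_tail (R : realType) (Q : {measure set R -> \bar R}) (x y : R) :
  (x <= y)%R -> tail Q y <= tail Q x.
Proof.
move=> xy; apply: le_measure; rewrite ?inE//.
by move=> z /=; rewrite !in_itv/= !andbT; exact: le_lt_trans.
Qed.

Definition jump_box (R : realType) (q : R) : set (R * R * R) :=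
  (`]0%R, +oo[%classic `*` `[0%R, 1%R]%classic) `*` `]q, +oo[%classic.

Lemma measurable_jump_box (R : realType) (q : R) : measurable (jump_box R q).
Proof. by apply: measurableX => //; exact: measurableX. Qed.

Lemma supOU_intensity_box (R : realType)
    (pi lambda : {measure set R -> \bar R}) (q : R) :
  moment 0%R pi = +oo -> 0 < tail lambda q ->
  supOU_intensity pi lambda (jump_box R q) = +oo.
Proof.
rewrite moment0 => piy q0.
rewrite /supOU_intensity product_measure1_rectangle; last exact: measurableX.
have leb01 : lebesgue_measure `[0%R, 1%R]%classic = 1 :> \bar R.
  by rewrite lebesgue_measure_itv/= lte_fin ltr01 oppr0 adde0.
rewrite [X in _ * X]product_measure1_rectangle//.
rewrite [X in _ * (X * _)](_ : _ = 1); last exact: leb01.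
by rewrite piy mul1e muleC gt0_mulye.
Qed.

(** A measure that is a sum of Dirac masses at points outside a set does not
    charge that set, whereas a Poisson random measure is almost surely infinite
    on a set of infinite intensity. *)
Lemma ae_point_in (R : realType) (d : measure_display)
    (Omega : measurableType d) (P : probability Omega R)
    (nu : set (R * R * R) -> \bar R) (N : R.-ker Omega ~> (R * R * R)%type)
    (xi tau zeta : nat -> {RV P >-> R}) (A : set (R * R * R)) :
  poisson_random_measure P nu N -> has_points N xi tau zeta ->
  measurable A -> nu A = +oo ->
  \forall w \ae P, exists k, A (xi k w, tau k w, zeta k w).
Proof.
move=> [_ Ny _] [_ NE] mA nuAy; have := Ny A mA nuAy.
apply: filterS2 NE => w /(_ A mA) NwE NwAy.
apply: contrapT => noA.
suff : N w A = 0 by rewrite NwAy.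
rewrite NwE eseries0// => k _ _; rewrite diracE memNset// => Ak.
by apply: noA; exists k.
Qed.

(** The other terms of the sum are nonnegative, and the [k]-th one carries the
    damping factor [exp 0 = 1] at time [tau k]. *)
Lemma le_supOU_jump (R : realType) (d : measure_display)
    (Omega : measurableType d) (P : probability Omega R)
    (xi tau zeta : nat -> {RV P >-> R}) (k : nat) (w : Omega) :
  (forall j, 0 <= zeta j w)%R ->
  (zeta k w)%:E <= supOU xi tau zeta (tau k w) w.
Proof.
move=> zeta_ge0; apply: esum_ge; exists [set k].
  by split; [exact: finite_set1|move=> _ ->; exact: lexx].
by rewrite fsbig_set1 subrr mulr0 expR0 mul1r.
Qed.

(** Density of the rationals lets a countable family of inequalities bound a
    supremum, provided the set of levels is closed downwards. *)
Lemma ereal_sup_le_rat (R : realType) (S : set R) (M : \bar R) :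
  (forall x y, (x <= y)%R -> S y -> S x) ->
  (forall q : rat, S (ratr q) -> (ratr q)%:E <= M) ->
  ereal_sup [set z%:E | z in S] <= M.
Proof.
move=> downS SM; apply: ge_ereal_sup => _ [z Sz <-].
have SMz (q : rat) : (ratr q < z)%R -> (ratr q)%:E <= M.
  by move=> qz; apply: SM; exact: downS (ltW qz) Sz.
case: M SMz {SM} => [m| |] SMz; last 2 first.
- by rewrite leey.
- have [q] : exists q, ratr q \in `](z - 1)%R, z[.
    by apply: rat_in_itvoo; rewrite ltrBlDr ltrDl.
  by rewrite in_itv/= => /andP[_ /SMz].
rewrite lee_fin leNgt; apply/negP => /rat_in_itvoo[q].
rewrite in_itv/= => /andP[mq /SMz]; rewrite lee_fin.
by rewrite leNgt mq.
Qed.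

Theorem proposition1 (R : realType) (d : measure_display)
    (Omega : measurableType d) (P : probability Omega R)
    (pi lambda : {measure set R -> \bar R})
    (mu : R.-ker Omega ~> (R * R * R)%type)
    (xi tau zeta : nat -> {RV P >-> R})
    (pi_pos : on_positive pi)
    (pi_int : moment (-1)%R pi < +oo)
    (lambda_levy : levy_measure lambda)
    (lambda_neq0 : lambda [set: R] != 0)
    (lambda_log : \int[lambda]_(z in `]1%R, +oo[) (ln z)%:E < +oo)
    (mu_poisson : poisson_random_measure P (supOU_intensity pi lambda) mu)
    (mu_points : has_points mu xi tau zeta)
    (lambda_small : \int[lambda]_(z in `]0%R, 1%R]) z%:E < +oo)
    (pi_infinite : moment 0%R pi = +oo) :
  (\forall w \ae P,
     ereal_sup [set z%:E | z in [set z : R | (0 < z)%R /\ 0 < tail lambda z]]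
     <= ereal_sup [set supOU xi tau zeta t w | t in `[0%R, 1%R]]) /\
  ((forall z : R, (0 < z)%R -> 0 < tail lambda z) ->
   \forall w \ae P,
     ereal_sup [set supOU xi tau zeta t w | t in `[0%R, 1%R]] = +oo).
Proof.
have supOU_ge_level (q : R) : 0 < tail lambda q -> \forall w \ae P,
    q%:E <= ereal_sup [set supOU xi tau zeta t w | t in `[0%R, 1%R]].
  move=> /(supOU_intensity_box _ pi lambda q pi_infinite).
  move=> /(ae_point_in _ _ _ _ _ _ _ _ _ _
    mu_poisson mu_points (measurable_jump_box _ q)).
  apply: filterS => w [k [[_ tau01]]]; rewrite /= in_itv/= andbT => q_zeta.
  apply: le_ereal_sup_tmp; exists (supOU xi tau zeta (tau k w) w).
    by exists (tau k w).
  apply: (@le_trans _ _ (zeta k w)%:E); first by rewrite lee_fin ltW.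
  by apply: le_supOU_jump => j; rewrite ltW// (mu_points.1 j w).2.
have supOU_ge : \forall w \ae P,
    ereal_sup [set z%:E | z in [set z : R | (0 < z)%R /\ 0 < tail lambda z]]
    <= ereal_sup [set supOU xi tau zeta t w | t in `[0%R, 1%R]].
  (* The rationals are enumerated through their codes [n], which turns the
     countably many null sets into a sequence. *)
  have : \forall w \ae P, forall n (q : rat), unpickle n = Some q ->
      0 < tail lambda (ratr q) -> (ratr q)%:E <=
      ereal_sup [set supOU xi tau zeta t w | t in `[0%R, 1%R]].
    apply: ae_foralln => n; case: (unpickle n) => [q|]; last first.
      by apply: aeW.
    have [q0|q0] := pselect (0 < tail lambda (ratr q)).
      by apply: filterS (supOU_ge_level _ q0) => w qM _ [<-].
    by apply: aeW => w _ [<-] /q0.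
  apply: filterS => w ratM.
  apply: (@le_trans _ _
    (ereal_sup [set z%:E | z in [set z : R | 0 < tail lambda z]])).
    by apply: ereal_sup_le => _ [z [_ z0] <-]; exists z.
  apply: ereal_sup_le_rat => [x y xy|q].
    by move=> /lt_le_trans; apply; exact: le_tail.
  exact: ratM (pickleK q).
split=> // unbounded; apply: filterS supOU_ge => w.
suff -> : ereal_sup [set z%:E | z in
    [set z : R | (0 < z)%R /\ 0 < tail lambda z]] = +oo.
  by rewrite leye_eq => /eqP.
apply: hasNub_ereal_sup; last first.
  by exists 1%R; split; [exact: ltr01|exact/unbounded/ltr01].
move=> [u ubu].
have u1 : (0 < `|u| + 1)%R by rewrite ltr_wpDl.
have := ubu _ (conj u1 (unbounded _ u1)).
by rewrite leNgt (le_lt_trans (ler_norm u))// ltrDl.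
Qed.
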